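(* Let $n\ge 2$, let $G=SD_{8n}$ be regarded as a subgroup of $S_{4n}$, let $\varsigma=\varsigma_h$ with $h\in C^{\dag}_{even}=\{2,4,\dots,2n-2\}$, and let $V$ be a complex inner product space with $d=\dim V\ge 2$ (finite). Then $V_\varsigma(G)$ has an orthogonal $\ast$-basis if and only if $\nu_2\big(\frac{h}{2n}\big)<0$.
   Context: $SD_{8n}=\langle a,b\mid a^{4n}=b^2=1,\ bab=a^{2n-1}\rangle$ is the semi-dihedral group of order $8n$, with elements $a^k, ba^k$ ($0\le k\le 4n-1$). It is regarded as a subgroup of $S_{4n}$ (permutations of $\{1,\dots,4n\}$, identified with the residues modulo $4n$) via $a: t\mapsto t+1$ and $b:t\mapsto (2n-1)t$ modulo $4n$. $\varsigma_h$ is the degree 2 irreducible character of $SD_{8n}$ with $\varsigma_h(a^k)=2\cos(\frac{hk\pi}{2n})$ and $\varsigma_h(ba^k)=0$ for all $k$. $\nu_2$ is the 2-adic valuation on nonzero rationals: $\nu_2(2^k p/q)=k$ for $p,q$ odd. For $G\le S_{4n}$ and an irreducible complex character $\chi$ of $G$, $P_\sigma(v_1\otimes\cdots\otimes v_{4n})=v_{\sigma^{-1}(1)}\otimes\cdots\otimes v_{\sigma^{-1}(4n)}$ on $\bigotimes^{4n}V$, and the symmetry class of tensors $V_\chi(G)$ is the image of $T(G,\chi)=\frac{\chi(1)}{|G|}\sum_{\sigma\in G}\chi(\sigma)P_\sigma$, with the inner product induced from the one on $V$. Fix an orthonormal basis $\{e_1,\dots,e_d\}$ of $V$. For a sequence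 $\alpha=(\alpha_1,\dots,\alpha_{4n})$ with $1\le\alpha_i\le d$, put $e^*_\alpha=T(G,\chi)(e_{\alpha_1}\otimes\cdots\otimes e_{\alpha_{4n}})$. An orthogonal $\ast$-basis of $V_\chi(G)$ is an orthogonal basis of $V_\chi(G)$ consisting of decomposable symmetrized tensors of the form $e^*_\alpha$. *)

(* Defs.v *)
From HB Require Import structures.
From mathcomp Require Import all_boot all_order all_fingroup all_algebra.
From mathcomp Require Import mxrepresentation complex reals trigo.
From mathcomp Require Import ring lra zify.

Set Implicit Arguments.
Unset Strict Implicit.
Unset Printing Implicit Defensive.

Import Order.TTheory GRing.Theory Num.Theory.
Local Open Scope ring_scope.

(* The tensor power of V with factors indexed by I, in coordinates with respect
   to the product basis (e_alpha) given by a basis e = (e_0, ..., e_(d-1)) of V: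
   x alpha is the coefficient of x on e_alpha = \bigotimes_(i in I) e_(alpha i).
   The lemmas tensor_multilinear, tensor_basis, tdot_tensor and P_tensor below
   check that tensor, tdot and P_ are the usual decomposable tensors, induced
   inner product and permutation operators. *)
Notation tpower C I d := {ffun {ffun I -> 'I_d} -> C^o}.

Section TensorPower.
Variables (C : numClosedFieldType) (I : finType) (d : nat).
Local Notation W := (tpower C I d).

Definition tdot (x y : W) : C := \sum_alpha x alpha * (y alpha)^*.

Fact tdot_linearl y : linear_for *%R (tdot^~ y).
Proof.
move=> a u v; rewrite /tdot mulr_sumr -big_split; apply: eq_bigr => k _ /=.
by rewrite !ffunE mulrDl mulrA.
Qed.

Fact tdot_linearr x : linear_for (Num.conj \; *%R) (tdot x).
Proof.
move=> a u v; rewrite /tdot /= mulr_sumr -big_split; apply: eq_bigr => k _ /=.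
by rewrite !ffunE rmorphD rmorphM /= mulrDr mulrCA.
Qed.

HB.instance Definition _ := @bilinear_isBilinear.Build C W W C
  *%R (Num.conj \; *%R) tdot (tdot_linearl, tdot_linearr).

Fact tdot_hermitian x y : tdot x y = (-1) ^+ false * (tdot y x)^*.
Proof.
rewrite mul1r /tdot rmorph_sum; apply: eq_bigr => k _ /=.
by rewrite rmorphM /= conjCK mulrC.
Qed.

HB.instance Definition _ := @isHermitianSesquilinear.Build C W false Num.conj
  tdot tdot_hermitian.

Fact tdot_gt0 x : x != 0 -> 0 < tdot x x.
Proof.
move=> nz; have [k nzk] : exists k, x k != 0.
  apply/existsP; apply: contraNT nz => /existsPn z; apply/eqP/ffunP => k.
  by rewrite ffunE; apply/eqP; move: (z k); rewrite negbK.
rewrite /tdot (bigD1 k) //= ltr_wpDr //.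
  by apply: sumr_ge0 => j _; rewrite mul_conjC_ge0.
by rewrite mul_conjC_gt0.
Qed.

HB.instance Definition _ := @isDotProduct.Build C W tdot tdot_gt0.

Definition permute (s : {perm I}) (x : W) : W :=
  [ffun alpha : {ffun I -> 'I_d} => x [ffun i => alpha (s i)]].

Fact permute_linear s : linear (permute s).
Proof. by move=> a u v; apply/ffunP => k; rewrite !ffunE. Qed.

HB.instance Definition _ s :=
  GRing.isLinear.Build C W W _ (permute s) (permute_linear s).

Definition P_ (s : {perm I}) : 'End(W) := linfun (permute s).

Definition symT (G : {set {perm I}}) (chi : {perm I} -> C) : 'End(W) :=
  (chi 1%g / #|G|%:R) *: \sum_(s in G) chi s *: P_ s.

Definition symclass (G : {set {perm I}}) (chi : {perm I} -> C) : {vspace W} :=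
  limg (symT G chi).

Variables (V : vectType C) (e : d.-tuple V).

Definition tensor (v : I -> V) : W :=
  [ffun alpha : {ffun I -> 'I_d} => \prod_i coord e (alpha i) (v i)].

Definition estar (G : {set {perm I}}) (chi : {perm I} -> C)
    (alpha : {ffun I -> 'I_d}) : W :=
  symT G chi (tensor (fun i => tnth e (alpha i))).

(* The library's pairwise_orthogonal also requires 0 \notin X, which basis_of
   implies anyway. *)
Definition has_orthogonal_starbasis (G : {set {perm I}})
    (chi : {perm I} -> C) : Prop :=
  exists X : seq W, [/\ basis_of (symclass G chi) X,
    pairwise_orthogonal tdot X
  & forall x, x \in X -> exists alpha, x = estar G chi alpha].

Lemma tensor_multilinear (v : I -> V) (i : I) :
  linear (fun u => tensor (fun j => if j == i then u else v j)).
Proof.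
move=> a u w; apply/ffunP => alpha; rewrite !ffunE.
rewrite !(bigD1 i (P := xpredT)) //= !eqxx linearP /= mulrDl -mulrA.
congr (_ * (_ * _) + _ * _); apply: eq_bigr => j /negbTE nj; by rewrite nj.
Qed.

Lemma tensor_basis (alpha beta : {ffun I -> 'I_d}) : free e ->
  tensor (fun i => tnth e (alpha i)) beta = (beta == alpha)%:R.
Proof.
move=> fe; rewrite ffunE.
have E i : coord e (beta i) (tnth e (alpha i)) = (beta i == alpha i)%:R.
  by rewrite (tnth_nth 0) coord_free // eq_sym.
under eq_bigr => i _ do rewrite E.
have [->|ne] := eqVneq; first by rewrite big1 // => i _; rewrite eqxx.
have [i ni] : exists i, beta i != alpha i.
  apply/existsP; apply: contraNT ne => /existsPn z; apply/eqP/ffunP => k.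
  by apply/eqP; move: (z k); rewrite negbK.
by rewrite (bigD1 i) //= (negbTE ni) mul0r.
Qed.

Lemma P_tensor (s : {perm I}) (v : I -> V) :
  P_ s (tensor v) = tensor (fun i => v ((s^-1)%g i)).
Proof.
apply/ffunP => alpha; rewrite lfunE !ffunE [RHS](reindex_inj (@perm_inj _ s)).
by apply: eq_bigr => i _; rewrite ffunE permK.
Qed.

Lemma tdot_tensor (dotV : {dot V for Num.conj}) (v w : I -> V) :
    basis_of fullv e -> orthonormal dotV e ->
  tdot (tensor v) (tensor w) = \prod_i dotV (v i) (w i).
Proof.
move=> be /orthonormalP [ue oe].
have E i : dotV (v i) (w i) =
    \sum_(k < d) coord e k (v i) * (coord e k (w i))^*.
  rewrite {1}(coord_basis be (memvf (v i))) linear_sumlz /=.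
  apply: eq_bigr => k _; rewrite linearZl_LR /=; congr (_ * _).
  rewrite {1}(coord_basis be (memvf (w i))) linear_sumr /= (bigD1 k) //=.
  rewrite linearZr_LR /= oe ?mem_nth ?size_tuple // eqxx mulr1 big1 ?addr0 //.
  move=> j njk; rewrite linearZr_LR /= oe ?mem_nth ?size_tuple //.
  by rewrite nth_uniq ?size_tuple // eq_sym (inj_eq val_inj) (negbTE njk) mulr0.
under [RHS]eq_bigr => i _ do rewrite E.
rewrite bigA_distr_bigA /=; apply: eq_bigr => k _.
by rewrite !ffunE rmorph_prod -big_split.
Qed.

End TensorPower.

Section SemiDihedral.
Variable n : nat.

Fact natr_Zp4n : ((4 * n)%:R = 0 :> 'Z_(4 * n)).
Proof.
have [->|n0] := posnP n; first by rewrite muln0.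
by rewrite pchar_Zp // (@leq_trans 4) // leq_pmulr.
Qed.

Fact sdmul_sqr : (2 * n%:R - 1) ^+ 2 = 1 :> 'Z_(4 * n).
Proof.
have -> : (2 * n%:R - 1) ^+ 2 = (4 * n)%:R * (n%:R - 1) + 1 :> 'Z_(4 * n).
  rewrite natrM; ring.
by rewrite natr_Zp4n mul0r add0r.
Qed.

Fact sdmul_inj : injective (fun t : 'Z_(4 * n) => (2 * n%:R - 1) * t).
Proof.
apply: (can_inj (g := fun t => (2 * n%:R - 1) * t)) => t.
by rewrite mulrA -expr2 sdmul_sqr mul1r.
Qed.

(* Products of permutations compose from left to right in fingroup; with either
   convention SD consists of the a^k and b a^k (sd_elements), has order 8n
   (card_SD) and satisfies the semi-dihedral relations (sda_order, sdb_order,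
   sd_rel). *)
Definition sda : {perm 'Z_(4 * n)} := perm (addIr (1 : 'Z_(4 * n))).
Definition sdb : {perm 'Z_(4 * n)} := perm sdmul_inj.
Definition SD : {group {perm 'Z_(4 * n)}} := <<[set sda; sdb]>>%G.

Lemma sda_expE k t : (sda ^+ k)%g t = t + k%:R.
Proof.
elim: k => [|k IH]; first by rewrite expg0 perm1 addr0.
by rewrite expgSr permM IH permE /= -addrA natr1.
Qed.

Lemma sdbE t : sdb t = (2 * n%:R - 1) * t. Proof. by rewrite permE. Qed.

Lemma sda_order : (sda ^+ (4 * n) = 1)%g.
Proof. by apply/permP => t; rewrite sda_expE natr_Zp4n addr0 perm1. Qed.

Lemma sdb_order : (sdb ^+ 2 = 1)%g.
Proof.
by apply/permP => t; rewrite permM !sdbE mulrA -expr2 sdmul_sqr mul1r perm1.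
Qed.

Lemma sda_expb k : (0 < n)%N -> (sda ^+ k * sdb = sdb * sda ^+ ((2 * n - 1) * k))%g.
Proof.
move=> n0; apply/permP => t; rewrite !permM !sdbE !sda_expE mulrDr; congr (_ + _).
by rewrite natrM natrB ?muln_gt0 // natrM.
Qed.

Lemma sd_rel : (0 < n)%N -> (sdb * sda * sdb = sda ^+ (2 * n - 1))%g.
Proof.
move=> n0; rewrite -mulgA -{1}(expg1 sda) sda_expb // muln1 mulgA.
by rewrite -(expgS _ 1) sdb_order mul1g.
Qed.

Lemma sda_exp_mod k : (sda ^+ k = sda ^+ (k %% (4 * n)))%g.
Proof.
by rewrite {1}(divn_eq k (4 * n)) expgD (mulnC (k %/ _)%N) expgM sda_order expg1n mul1g.
Qed.

Lemma sda_exp_inj (i j : 'I_(4 * n)) : (0 < n)%N ->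
  (sda ^+ i = sda ^+ j)%g -> i = j.
Proof.
move=> n0 /permP /(_ 0); rewrite !sda_expE !add0r => E.
have p1 : (1 < 4 * n)%N by rewrite (@leq_trans 4) // leq_pmulr.
move/(congr1 val): E; rewrite /= !val_Zp_nat // !modn_small // => E.
exact: val_inj.
Qed.

Lemma sdb_notin (i j : nat) : (1 < n)%N -> (sda ^+ i != sdb * sda ^+ j)%g.
Proof.
move=> n1; apply/eqP => /permP E.
have p1 : (1 < 4 * n)%N by rewrite (@leq_trans 4) // leq_pmulr // ltnW.
have := E 1; have := E 0.
rewrite !permM !sdbE !sda_expE mulr0 !add0r mulr1 => -> /addIr.
rewrite -[2]/(2%:R) -natrM -[1]/(1%:R) -natrB ?muln_gt0 ?(ltnW n1) //.
by move/(congr1 val); rewrite /= !val_Zp_nat // !modn_small //; lia.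
Qed.

Lemma sd_elements : (0 < n)%N -> SD =i
  [pred s | [exists k : 'I_(4 * n), (s == sda ^+ k)%g || (s == sdb * sda ^+ k)%g]].
Proof.
move=> n0 s; rewrite inE.
have p0 : (0 < 4 * n)%N by rewrite muln_gt0.
pose A := [set s | [exists k : 'I_(4 * n), (s == sda ^+ k)%g || (s == sdb * sda ^+ k)%g]].
have inAa k : (sda ^+ k)%g \in A.
  rewrite inE; apply/existsP; exists (Ordinal (ltn_pmod k p0)).
  by rewrite /= -sda_exp_mod eqxx.
have inAb k : (sdb * sda ^+ k)%g \in A.
  rewrite inE; apply/existsP; exists (Ordinal (ltn_pmod k p0)).
  by rewrite /= -sda_exp_mod eqxx orbT.
have Agr : group_set A.
  apply/group_setP; split; first by rewrite -(expg0 sda).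
  move=> x y; rewrite !inE => /existsP [i /orP[]/eqP ->] /existsP [j /orP[]/eqP ->].
  - by have := inAa (i + j)%N; rewrite expgD inE.
  - have := inAb ((2 * n - 1) * i + j)%N.
    by rewrite expgD mulgA -sda_expb // mulgA inE.
  - by have := inAb (i + j)%N; rewrite expgD mulgA inE.
  - have := inAa ((2 * n - 1) * i + j)%N.
    rewrite expgD -[X in (X * _)%g]mul1g -sdb_order expgS expg1 -(mulgA sdb).
    by rewrite -sda_expb // !mulgA inE.
suff -> : s \in SD = (s \in A) by rewrite inE.
apply/idP/idP.
  have sub : (<<[set sda; sdb]>> \subset Group Agr)%g.
    rewrite gen_subG; apply/subsetP => x /set2P [] ->.
      exact: (inAa 1%N).
    by have := inAb 0%N; rewrite expg0 mulg1.
  by move=> /(subsetP sub).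
have aG : sda \in SD by rewrite mem_gen // set21.
have bG : sdb \in SD by rewrite mem_gen // set22.
by rewrite inE => /existsP [k /orP[]/eqP ->]; rewrite ?groupM ?groupX.
Qed.

Lemma card_SD : (1 < n)%N -> #|SD| = (8 * n)%N.
Proof.
move=> n1; have n0 := ltnW n1.
pose f (x : 'I_(4 * n) + 'I_(4 * n)) : {perm 'Z_(4 * n)} :=
  match x with inl k => sda ^+ k | inr k => sdb * sda ^+ k end%g.
have finj : injective f.
  move=> [i|i] [j|j] /=.
  - by move/sda_exp_inj => ->.
  - by move/eqP; rewrite (negbTE (sdb_notin _ _ n1)).
  - by move/esym/eqP; rewrite (negbTE (sdb_notin _ _ n1)).
  - by move/mulgI/sda_exp_inj => ->.
rewrite -[RHS](_ : #|codom f| = _); last first.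
  by rewrite card_codom // card_sum card_ord -mulnDl.
apply: eq_card => s; rewrite sd_elements // inE.
apply/existsP/codomP => [[k /orP[]/eqP ->]|[[k|k] ->]].
- by exists (inl k).
- by exists (inr k).
- by exists k; rewrite eqxx.
- by exists k; rewrite eqxx orbT.
Qed.

End SemiDihedral.

Section CharSigma.
Variables (R : realType) (n h : nat).

(* The irreducible character of degree 2 with value 2 cos (h k pi / 2n) at a^k
   and 0 at b a^k, extended by 0 outside SD n; see varsigma_irreducible. *)
Definition varsigma (s : {perm 'Z_(4 * n)}) : R[i] :=
  if [pick k : 'I_(4 * n) | s == (sda n ^+ k)%g] is Some k
  then (2 * cos (h%:R * k%:R * pi / (2 * n%:R)))%:C%C else 0.

Lemma varsigma_a (k : 'I_(4 * n)) : (0 < n)%N ->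
  varsigma (sda n ^+ k) = (2 * cos (h%:R * k%:R * pi / (2 * n%:R)))%:C%C.
Proof.
rewrite /varsigma => n0; case: pickP => [j /eqP /sda_exp_inj -> //|/(_ k)].
by rewrite eqxx.
Qed.

Lemma varsigma_b k : (1 < n)%N -> varsigma (sdb n * sda n ^+ k) = 0.
Proof.
rewrite /varsigma => n1; case: pickP => [j /eqP E|//].
by have := sdb_notin j k n1; rewrite E eqxx.
Qed.

Let cis (x : R) : R[i] := (cos x +i* sin x)%C.

Let cisD x y : cis (x + y) = cis x * cis y.
Proof. by apply/eqP; rewrite eq_complex /= cosD sinD addrC [X in _ && (X == _)]addrC !eqxx. Qed.

Let cis0 : cis 0 = 1. Proof. by rewrite /cis cos0 sin0. Qed.

Let cis2pi m : cis (pi *+ 2 *+ m) = 1.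
Proof.
rewrite -[_ *+ m]add0r /cis !periodicn; first exact: cis0.
- exact: sinD2pi.
- exact: cosD2pi.
Qed.

Let th : R := h%:R * pi / (2 * n%:R).

Let D (k : nat) : 'M[R[i]]_2 :=
  \matrix_(i, j) (if i == j then cis (if i == 0 then th *+ k else - (th *+ k))
                  else 0).
Let B : 'M[R[i]]_2 := \matrix_(i, j) (i != j)%:R.

Let ord2 (i : 'I_2) : i = 0 \/ i = 1.
Proof. by case: i => [[|[|]] //= ?]; [left|right]; apply: val_inj. Qed.

Let sum2 (F : 'I_2 -> R[i]) : \sum_i F i = F 0 + F 1.
Proof. by rewrite big_ord_recl big_ord1; congr (_ + F _); apply: val_inj. Qed.

Let D0 : D 0 = 1%:M.
Proof.
apply/matrixP => i j; rewrite !mxE; case: eqP => // _.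
by rewrite mulr0n oppr0 if_same cis0.
Qed.

Let DD i j : D (i + j) = D i *m D j.
Proof.
apply/matrixP => p q; rewrite !mxE sum2 !mxE mulrnDr.
by case: (ord2 p) => ->; case: (ord2 q) => ->;
  rewrite /= ?mulr0 ?mul0r ?addr0 ?add0r -?cisD ?opprD.
Qed.

Let BB : B *m B = 1%:M.
Proof.
apply/matrixP => p q; rewrite !mxE sum2 !mxE.
by case: (ord2 p) => ->; case: (ord2 q) => ->;
  rewrite /= ?mulr0 ?mul0r ?addr0 ?add0r ?mulr1.
Qed.

Hypotheses (n1 : (1 < n)%N) (evh : ~~ odd h).
Let n0 : (0 < n)%N := ltnW n1.

Let th2n : th *+ (2 * n) = pi *+ 2 *+ h./2.
Proof.
rewrite -[in LHS](mulr_natr th) /th natrM -mulrA mulVf; last first.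
  by rewrite mulf_neq0 // pnatr_eq0 // -lt0n.
rewrite mulr1 -mulrnA mulr_natl mul2n; congr (_ *+ _).
by rewrite -[LHS]odd_double_half (negbTE evh).
Qed.

Let thm m k : th *+ ((2 * n) * m + k) = pi *+ 2 *+ (h./2 * m) + th *+ k.
Proof. by rewrite mulrnDr mulrnA th2n -mulrnA. Qed.

Let Dmod k : D (k %% (4 * n)) = D k.
Proof.
rewrite [in RHS](divn_eq k (4 * n)) DD -[LHS]mul1mx; congr (_ *m _).
apply/matrixP => p q; rewrite !mxE.
have -> : (k %/ (4 * n) * (4 * n) = 2 * n * (2 * (k %/ (4 * n))) + 0)%N by ring.
rewrite thm mulr0n addr0.
have E : cis (- (pi *+ 2 *+ (h./2 * (2 * (k %/ (4 * n)))))) = 1.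
  by apply: (mulfI (x := 1)); rewrite ?oner_eq0 // -{1}(cis2pi (h./2 * (2 * (k %/ (4 * n))))) -cisD subrr cis0 mulr1.
by case: (ord2 p) => ->; case: (ord2 q) => ->; rewrite /= ?cis2pi ?E.
Qed.

Let DB k : D k *m B = B *m D ((2 * n - 1) * k).
Proof.
have E : cis (th *+ ((2 * n - 1) * k)) = cis (- (th *+ k)).
  apply: (mulfI (x := cis (th *+ k))).
    apply: contraTneq (oner_neq0 R[i]) => z.
    by rewrite -cis0 -(subrr (th *+ k)) cisD z mul0r eqxx.
  rewrite -!cisD subrr cis0 -mulrnDr -mulSn.
  have -> : ((2 * n - 1).+1 * k = 2 * n * k + 0)%N by lia.
  by rewrite thm mulr0n addr0 cis2pi.
have E' : cis (- (th *+ ((2 * n - 1) * k))) = cis (th *+ k).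
  apply: (mulfI (x := cis (th *+ ((2 * n - 1) * k)))).
    apply: contraTneq (oner_neq0 R[i]) => z.
    by rewrite -cis0 -(subrr (th *+ ((2 * n - 1) * k))) cisD z mul0r eqxx.
  by rewrite -cisD subrr E -cisD addNr.
apply/matrixP => p q; rewrite !mxE !sum2 !mxE.
by case: (ord2 p) => ->; case: (ord2 q) => ->;
  rewrite /= ?mulr0 ?mul0r ?addr0 ?add0r ?mulr1 ?mul1r ?E ?E'.
Qed.

Let rho (s : {perm 'Z_(4 * n)}) : 'M[R[i]]_2 :=
  let k := val (s 0) in if s == (sda n ^+ k)%g then D k else B *m D k.

Let valE k : val ((sda n ^+ k)%g 0) = (k %% (4 * n))%N.
Proof.
have p1 : (1 < 4 * n)%N by rewrite (@leq_trans 4) // leq_pmulr.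
by rewrite sda_expE add0r /= val_Zp_nat.
Qed.

Let rho_a k : rho (sda n ^+ k) = D k.
Proof. by rewrite /rho valE -sda_exp_mod eqxx Dmod. Qed.

Let rho_b k : rho (sdb n * sda n ^+ k) = B *m D k.
Proof.
rewrite /rho permM sdbE mulr0 valE eq_sym -sda_exp_mod.
by rewrite (negbTE (sdb_notin _ _ n1)) Dmod.
Qed.

Let rho_repr : mx_repr (SD n) rho.
Proof.
split; first by rewrite -(expg0 (sda n)) rho_a D0.
have p1 k : (sdb n * (sdb n * sda n ^+ k) = sda n ^+ k)%g.
  by rewrite mulgA -(expgS _ 1) sdb_order mul1g.
move=> x y; rewrite !sd_elements // => /existsP [i /orP[]/eqP ->].
  move=> /existsP [j /orP[]/eqP ->].
    by rewrite -expgD !rho_a DD.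
  by rewrite mulgA sda_expb // -mulgA -expgD rho_b rho_a rho_b mulmxA DB DD !mulmxA.
move=> /existsP [j /orP[]/eqP ->].
  by rewrite -mulgA -expgD !rho_b rho_a DD mulmxA.
rewrite -mulgA (mulgA _ (sdb n)) sda_expb // -mulgA -expgD p1 rho_a !rho_b.
by rewrite -mulmxA (mulmxA _ B) DB !mulmxA BB mul1mx DD.
Qed.

Lemma varsigma_irreducible : (0 < h < 2 * n)%N ->
  exists rG : mx_representation R[i] (SD n) 2,
    mx_irreducible rG /\ {in SD n, forall s, varsigma s = \tr (rG s)}.
Proof.
move=> /andP[h0 h2n]; exists (MxRepresentation rho_repr); split; last first.
  move=> s; rewrite sd_elements // => /existsP [k /orP[]/eqP ->] /=.
    rewrite varsigma_a // rho_a /mxtrace sum2 !mxE /= /cis cosN sinN.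
    have -> : h%:R * k%:R * pi / (2 * n%:R) = th *+ k :> R.
      by rewrite -mulr_natr /th; ring.
    by apply/eqP; rewrite eq_complex /= subrr eqxx andbT; apply/eqP; ring.
  rewrite varsigma_b // rho_b /mxtrace sum2 !mxE !sum2 !mxE /=.
  by rewrite !mulr0 !mul0r !addr0.
have nz : cis th - cis (- th) != 0.
  have th0 : 0 < th < pi.
    have tn0 : 0 < 2 * n%:R :> R by rewrite mulr_gt0 // ltr0n.
    rewrite /th divr_gt0 ?mulr_gt0 ?pi_gt0 ?ltr0n //=.
    by rewrite ltr_pdivrMr // mulrC ltr_pM2l ?pi_gt0 // -natrM ltr_nat.
  have s0 := sin_gt0_pi th0.
  apply: contraTneq s0 => /(congr1 (@complex.Im R)) /=.
  by rewrite sinN; lra.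
split; first exact: mxmodule1.
  by rewrite -mxrank_eq0 mxrank1.
move=> U modU _ Unz; rewrite sub1mx.
have stab s : s \in SD n -> (U *m rho s <= U)%MS.
  by move=> sG; exact: (mxmoduleP modU).
have aG : (sda n \in SD n) by rewrite mem_gen // set21.
have bG : (sdb n \in SD n) by rewrite mem_gen // set22.
have sA : (U *m D 1 <= U)%MS by rewrite -rho_a; apply: stab; rewrite expg1.
have sB : (U *m B <= U)%MS.
  by rewrite -[B]mulmx1 -D0 -rho_b; apply: stab; rewrite expg0 mulg1.
have sub (v : 'rV[R[i]]_2) (M : 'M[R[i]]_2) : (U *m M <= U)%MS -> (v <= U)%MS ->
    (v *m M <= U)%MS.
  by move=> sM vU; apply: submx_trans sM; apply: submxMr.
pose e0 : 'rV[R[i]]_2 := delta_mx 0 0.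
pose e1 : 'rV[R[i]]_2 := delta_mx 0 1.
have e0B : e0 *m B = e1.
  apply/rowP => j; rewrite !mxE sum2 !mxE.
  by case: (ord2 j) => -> /=; rewrite ?mulr0 ?mul0r ?mulr1 ?addr0.
have e1B : e1 *m B = e0.
  apply/rowP => j; rewrite !mxE sum2 !mxE.
  by case: (ord2 j) => -> /=; rewrite ?mulr0 ?mul0r ?mulr1 ?addr0 ?add0r.
have both : (e0 <= U)%MS -> row_full U.
  move=> s0; rewrite -sub1mx; apply/row_subP => i.
  rewrite rowE mulmx1; case: (ord2 i) => -> //.
  by rewrite -/e1 -e0B; apply: sub.
have /matrix0Pn [i [j Uij]] := Unz.
pose v := row i U.
have vU : (v <= U)%MS by exact: row_sub.
have nz' : cis (- th) - cis th != 0 by rewrite -opprB oppr_eq0.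
have key (c : R[i]) k : v 0 k != 0 -> c != 0 ->
    v *m (D 1 - (cis (if k == 0 then - th else th))%:M)
      = (v 0 k * c) *: delta_mx 0 k -> ((delta_mx 0 k : 'rV_2) <= U)%MS.
  move=> vk cn E; rewrite -(eqmx_scale _ (mulf_neq0 vk cn)) -E.
  by apply: (sub _ _ _ vU); rewrite mulmxBr addmx_sub // mul_mx_scalar eqmx_opp scalemx_sub.
have vE c : v *m (D 1 - c%:M) = \row_k (v 0 k * (cis (if k == 0 then th else - th) - c)).
  apply/rowP => k; rewrite !mxE sum2 !mxE.
  by case: (ord2 k) => -> /=; rewrite ?mulr1n ?mulr0n ?subr0 ?mulr0 ?addr0 ?add0r.
have : v 0 j != 0 by rewrite mxE.
case: (ord2 j) => -> vj.
  apply: both; apply: (key _ _ vj nz); rewrite vE.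
  by apply/rowP => k; rewrite !mxE; case: (ord2 k) => -> /=; rewrite ?subrr ?mulr0 ?mulr1.
apply: both; rewrite -e1B; apply: (sub _ _ sB); apply: (key _ _ vj nz'); rewrite vE.
by apply/rowP => k; rewrite !mxE; case: (ord2 k) => -> /=; rewrite ?subrr ?mulr0 ?mulr1.
Qed.

End CharSigma.

Arguments varsigma R n h s : clear implicits.

Definition nu2 (q : rat) : int :=
  (logn 2 `|numq q|)%:Z - (logn 2 `|denq q|)%:Z.

Lemma nu2_frac (a b : int) : a != 0 -> b != 0 ->
  nu2 (a%:Q / b%:Q) = (logn 2 `|a|)%:Z - (logn 2 `|b|)%:Z.
Proof.
rewrite /nu2; case: divqP => [_ _|k x knz + _]; first by rewrite eqxx.
rewrite mulf_eq0 negb_or => /andP[_ xnz].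
rewrite !abszM !lognM ?absz_gt0 ?denq_neq0 //; lia.
Qed.

Lemma nu2E (k p q : int) : odd `|p| -> odd `|q| ->
  nu2 ((2%:Q : rat) ^ k * p%:Q / q%:Q) = k.
Proof.
have nz (m : int) : odd `|m| -> m != 0 by case: eqP => // ->.
have lo (m : int) : odd `|m| -> logn 2 `|m| = 0%N.
  by move=> om; rewrite lognE dvdn2 om andbF.
have L (m : nat) (r : int) : odd `|r| -> logn 2 `|2 ^+ m * r| = m.
  move=> orr; rewrite abszM abszX lognM ?expn_gt0 ?absz_gt0 ?(nz r) //.
  by rewrite (lo r) // lognX addn0 muln1.
move=> op oq; case: k => m.
  rewrite -exprnP -rmorphXn -rmorphM /= nu2_frac ?mulf_neq0 ?expf_neq0 ?(nz p) ?(nz q) //.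
  by rewrite L // lo // subr0.
rewrite NegzE -exprnN.
rewrite [X in nu2 X](_ : _ = p%:Q / (2 ^+ m.+1 * q)%:Q); last first.
  by rewrite rmorphM rmorphXn /= invfM mulrA [p%:Q * _]mulrC.
by rewrite nu2_frac ?mulf_neq0 ?expf_neq0 ?(nz p) ?(nz q) // L // lo // sub0r.
Qed.

(* Main.v *)
Require Import Defs.
From mathcomp Require Import all_boot all_order all_fingroup all_algebra.
From mathcomp Require Import complex reals trigo.
From mathcomp Require Import ring lra zify.

Set Implicit Arguments.
Unset Strict Implicit.
Unset Printing Implicit Defensive.

Import Order.TTheory GRing.Theory Num.Theory.
Local Open Scope ring_scope.

(* The character vanishes on the b a^k, so only the rotations a^k contribute and
   e*_alpha has real coordinates, supported on the rotation orbit of alpha.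
   With theta = h pi / 2n, the product formula for cosines shows that the inner
   product of e*_(a^s alpha) and e*_(a^t alpha) is cos ((s - t) theta) times the
   squared norm of e*_alpha.  Hence every rotation orbit spans 0 or a plane in
   which the rotations of e*_alpha sit at angles s theta, and distinct orbits
   are orthogonal.  An orthogonal *-basis therefore exists if and only if
   cos (t theta) = 0 for some integer t: this is necessary because d > 1
   provides an orbit with e*_alpha nonzero, and sufficient because e*_alpha and
   e*_(a^t alpha) then form an orthogonal basis of the plane.  Finally
   cos (t theta) = 0 says that t h is an odd multiple of n. *)

(** * Cosines and sines of the multiples of h pi / 2n *)

Lemma cosDpin (R : realType) (x : R) q :
  cos (x + pi *+ q) = (-1) ^+ q * cos x.
Proof.
elim: q => [|q IH]; first by rewrite mulr0n addr0 mul1r.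
by rewrite mulrSr addrA cosD cospi sinpi IH exprS; ring.
Qed.

Section Angle.
Variables (R : realType) (n h : nat).
Hypothesis n1 : (1 < n)%N.

Definition angle : R := h%:R * pi / (2 * n%:R).
(** Residues modulo 4n can serve as indices because 4n times the angle is a multiple of 2 pi. *)
Definition csn (k : 'Z_(4 * n)) : R := cos (angle *+ k).
Definition snn (k : 'Z_(4 * n)) : R := sin (angle *+ k).

Lemma n_neq0 : n%:R != 0 :> R.
Proof. by rewrite pnatr_eq0 -lt0n ltnW. Qed.

Lemma angle_4n : angle *+ (4 * n) = pi *+ 2 *+ h.
Proof.
rewrite /angle -[LHS]mulr_natr -mulrnA -[RHS]mulr_natr !natrM.
by field; rewrite n_neq0.
Qed.

Lemma angle_mod m : angle *+ m =
  angle *+ (m %% (4 * n)) + pi *+ 2 *+ (h * (m %/ (4 * n))).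
Proof.
by rewrite {1}(divn_eq m (4 * n)) mulrnDr addrC (mulnC (m %/ _)%N)
  mulrnA angle_4n -!mulrnA.
Qed.

Lemma one_lt_4n : (1 < 4 * n)%N.
Proof. by move: n1; lia. Qed.

Lemma csn_natr m : csn m%:R = cos (angle *+ m).
Proof.
rewrite /csn val_Zp_nat ?one_lt_4n // [in RHS]angle_mod periodicn //.
exact: cosD2pi.
Qed.

Lemma snn_natr m : snn m%:R = sin (angle *+ m).
Proof.
rewrite /snn val_Zp_nat ?one_lt_4n // [in RHS]angle_mod periodicn //.
exact: sinD2pi.
Qed.

Lemma csnD k l : csn (k + l) = csn k * csn l - snn k * snn l.
Proof.
by rewrite -[k]natr_Zp -[l]natr_Zp -natrD !csn_natr !snn_natr mulrnDr cosD.
Qed.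

Lemma snnD k l : snn (k + l) = snn k * csn l + csn k * snn l.
Proof.
by rewrite -[k]natr_Zp -[l]natr_Zp -natrD !csn_natr !snn_natr mulrnDr sinD.
Qed.

Lemma csn0 : csn 0 = 1.
Proof. by rewrite /csn mulr0n cos0. Qed.

Lemma snn0 : snn 0 = 0.
Proof. by rewrite /snn mulr0n sin0. Qed.

Lemma csn2Dsnn2 k : csn k ^+ 2 + snn k ^+ 2 = 1.
Proof. exact: cos2Dsin2. Qed.

(** The representative of [- k] is not the negative of that of [k], so parity is solved from the
    addition formulas at k + (- k) = 0. *)
Lemma csnN k : csn (- k) = csn k.
Proof.
have := csnD k (- k); have := snnD k (- k); rewrite subrr csn0 snn0 => s c.
apply/eqP; rewrite -subr_eq0; apply/eqP.
transitivity (csn (- k) * (1 - (csn k ^+ 2 + snn k ^+ 2))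
    + csn k * (csn k * csn (- k) - snn k * snn (- k) - 1)
    + snn k * (snn k * csn (- k) + csn k * snn (- k))); first by ring.
by rewrite csn2Dsnn2 -c -s; ring.
Qed.

Lemma snnN k : snn (- k) = - snn k.
Proof.
have := csnD k (- k); have := snnD k (- k); rewrite subrr csn0 snn0 => s c.
apply/eqP; rewrite -subr_eq0 opprK; apply/eqP.
transitivity (snn (- k) * (1 - (csn k ^+ 2 + snn k ^+ 2))
    + csn k * (snn k * csn (- k) + csn k * snn (- k))
    - snn k * (csn k * csn (- k) - snn k * snn (- k) - 1)); first by ring.
by rewrite csn2Dsnn2 -c -s; ring.
Qed.

(** Write t h = 2 n q + r with r < 2 n. Up to sign the cosine is that of r pi / 2n, an angle of
    [0, pi], where cosine is injective and vanishes only at pi / 2, that is for r = n. *)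
Lemma csn_eq0P :
  (exists t, csn t = 0) <-> (exists t j, t * h = n * (2 * j + 1))%N.
Proof.
have nz := n_neq0.
have angleM t : angle *+ t = (t * h)%:R * (pi / (2 * n%:R)).
  by rewrite /angle -mulr_natr natrM; ring.
have n2 : (0 < 2 * n)%N by move: n1; lia.
have split_pi q r : (2 * n * q + r)%:R * (pi / (2 * n%:R)) =
    r%:R * (pi / (2 * n%:R)) + pi *+ q :> R.
  by rewrite -mulr_natr natrD !natrM; field.
have half : n%:R * (pi / (2 * n%:R)) = pi / 2 :> R by field.
split=> [[t]|[t [j E]]]; last first.
  exists t%:R; rewrite csn_natr angleM E.
  have -> : (n * (2 * j + 1) = 2 * n * j + n)%N by ring.
  by rewrite split_pi cosDpin half cos_pihalf mulr0.
rewrite /csn angleM => c0; exists t, (t * h %/ (2 * n))%N.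
set q := (_ %/ _)%N; set r := (t * h %% (2 * n))%N.
have E : (t * h = 2 * n * q + r)%N by rewrite [(2 * n * q)%N]mulnC -divn_eq.
have r_lt : (r < 2 * n)%N by rewrite ltn_mod.
suff rn : r = n by rewrite E rn; ring.
move: c0; rewrite E split_pi cosDpin => /eqP.
rewrite mulf_eq0 signr_eq0 /= -(cos_pihalf R) -half => /eqP/cos_inj.
have pos : 0 < pi / (2 * n%:R) :> R.
  by rewrite divr_gt0 ?pi_gt0 // mulr_gt0 // ltr0n ltnW.
have bnd m : (m <= 2 * n)%N -> m%:R * (pi / (2 * n%:R)) \in `[0, pi : R].
  move=> le; rewrite in_itv /= mulr_ge0 ?(ltW pos) //=.
  rewrite [leRHS](_ : pi = (2 * n)%:R * (pi / (2 * n%:R))); last first.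
    by rewrite natrM; field.
  by rewrite ler_pM2r // ler_nat.
rewrite !bnd; try by lia.
by move=> /(_ isT isT) /(mulIf (lt0r_neq0 pos)) /eqP; rewrite eqr_nat => /eqP.
Qed.

End Angle.

(** * The arithmetic condition in terms of 2-adic valuations *)

Lemma odd_multiple_nu2 (n h : nat) : (0 < n)%N -> (0 < h)%N ->
  (exists t j, t * h = n * (2 * j + 1))%N <-> nu2 (h%:Q / (2 * n)%N%:Q) < 0.
Proof.
move=> n0 h0.
have -> : (nu2 (h%:Q / (2 * n)%N%:Q) < 0) = (logn 2 h <= logn 2 n)%N.
  rewrite nu2_frac; [|by lia..].
  rewrite !absz_nat lognM // (_ : logn 2 2 = 1%N) //; lia.
split=> [[t [j E]]|le].
  have t0 : (0 < t)%N by case: t E => //; lia.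
  have := congr1 (logn 2) E; rewrite !lognM //; last by lia.
  by rewrite (@logn_coprime 2 (2 * j + 1)) ?coprime2n; lia.
have odd_part m : (0 < m)%N -> exists2 j, odd j & m = (2 ^ logn 2 m * j)%N.
  move=> m0; have [j cj E] := pfactor_coprime (isT : prime 2) m0.
  by exists j; [rewrite -coprime2n | rewrite mulnC].
have [h' oh Eh] := odd_part h h0; have [n' on En] := odd_part n n0.
(* With h' and n' the odd parts, this t gives t h = n h', and h' = 2 j + 1. *)
exists (2 ^ (logn 2 n - logn 2 h) * n')%N, h'./2.
rewrite [in RHS]En -[in RHS](subnK le) expnD [X in (_ * X)%N = _]Eh.
have -> : (2 * h'./2 + 1 = h')%N by rewrite -[RHS]odd_double_half oh; lia.
ring.
Qed.

(** * Rotations of multi-indices *)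

Section Rotation.
Variables (p : nat) (T : Type).
Implicit Types (k l : 'Z_p) (al : {ffun 'Z_p -> T}).

Definition rotz k al : {ffun 'Z_p -> T} := [ffun i => al (i + k)].

Lemma rotzD k l al : rotz k (rotz l al) = rotz (k + l) al.
Proof. by apply/ffunP => i; rewrite !ffunE addrA. Qed.

Lemma rotz0 al : rotz 0 al = al.
Proof. by apply/ffunP => i; rewrite !ffunE addr0. Qed.

Lemma rotzK k : cancel (rotz k) (rotz (- k)).
Proof. by move=> al; rewrite rotzD addNr rotz0. Qed.

Lemma rotzNK k : cancel (rotz (- k)) (rotz k).
Proof. by move=> al; rewrite rotzD subrr rotz0. Qed.

Lemma iter_rotz1 m al : iter m (rotz 1) al = rotz m%:R al.
Proof.
by elim: m => [|m IH]; rewrite ?rotz0 //= IH rotzD nat1r.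
Qed.

End Rotation.

(** * Coordinates and Gram kernel of the symmetrized tensors *)

Section RotationKernel.
Variables (R : realType) (n h d : nat).
Hypothesis n1 : (1 < n)%N.
Local Notation F := {ffun 'Z_(4 * n) -> 'I_d}.
Local Notation cs := (csn R h).
Local Notation sn := (snn R h).
Implicit Types (al be : F) (k s t : 'Z_(4 * n)).

(** The coordinate of e*_al on e_be: the scalar 2 / 8n of [symT] times the character value 2
    [cs k]. *)
Definition starw al be : R :=
  (2 * n%:R)^-1 * \sum_k cs k * (rotz k be == al)%:R.

Lemma starw_rotl s al be :
  starw (rotz s al) be = (2 * n%:R)^-1 * \sum_k cs (k + s) * (rotz k be == al)%:R.
Proof.
congr (_ * _); rewrite (reindex_inj (addIr s)) /=; apply: eq_bigr => k _.
by rewrite addrC -rotzD (inj_eq (can_inj (rotzK s))).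
Qed.

Lemma starw_rot2 s al be : starw (rotz s al) (rotz s be) = starw al be.
Proof.
congr (_ * _); apply: eq_bigr => k _.
by rewrite rotzD addrC -rotzD (inj_eq (can_inj (rotzK s))).
Qed.

(** Termwise this is cos (x + y) + cos (x - y) = 2 cos x cos y. *)
Lemma starw_rotDN s al be :
  starw (rotz s al) be + starw (rotz (- s) al) be = 2 * cs s * starw al be.
Proof.
rewrite !starw_rotl -mulrDr -big_split /= mulrCA; congr (_ * _).
rewrite mulr_sumr; apply: eq_bigr => k _.
by rewrite !csnD // csnN // snnN //; ring.
Qed.

(** When [cs t] is 0, [sn t] squares to 1, so the sine term of cos (k + s) can be rewritten with cos
    (k + t). Hence two rotations span the whole orbit. *)
Lemma starw_rot_pair s t al be : cs t = 0 ->
  starw (rotz s al) be = cs s * starw al be + sn s * sn t * starw (rotz t al) be.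
Proof.
move=> ct0; rewrite !starw_rotl /starw mulrCA [_ * _ * (_ * _)]mulrCA.
rewrite -mulrDr; congr (_ * _).
rewrite !mulr_sumr -big_split /=; apply: eq_bigr => k _.
have := csn2Dsnn2 R h t; rewrite ct0 expr0n add0r => st.
rewrite !csnD // ct0; transitivity
  ((cs k * cs s - sn k * sn s * sn t ^+ 2) * (rotz k be == al)%:R); last by ring.
by rewrite st mulr1.
Qed.

Definition gram al be : R := \sum_ga starw al ga * starw be ga.

Lemma gramC al be : gram al be = gram be al.
Proof. by apply: eq_bigr => ga _; rewrite mulrC. Qed.

Lemma gram_rot2 s al be : gram (rotz s al) (rotz s be) = gram al be.
Proof.
rewrite /gram (reindex_inj (can_inj (rotzK s))) /=.
by apply: eq_bigr => ga _; rewrite !starw_rot2.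
Qed.

(** By invariance only u = s - t matters. The values at u and - u are equal by invariance and
    symmetry, and [starw_rotDN] gives their sum. *)
Lemma gram_rot s t al : gram (rotz s al) (rotz t al) = cs (s - t) * gram al al.
Proof.
have -> : rotz s al = rotz t (rotz (s - t) al) by rewrite rotzD addrC subrK.
rewrite gram_rot2; set u := s - t.
have : gram (rotz u al) al + gram (rotz (- u) al) al = 2 * cs u * gram al al.
  rewrite /gram -big_split mulr_sumr; apply: eq_bigr => ga _ /=.
  by rewrite -mulrDl starw_rotDN mulrA.
by rewrite -[gram (rotz (- u) al) al](gram_rot2 u) rotzNK [gram al _]gramC; lra.
Qed.

(** Each [starw al] is supported on the orbit of [al], and overlapping supports force equal
    orbits. *)
Lemma gram_neq0_rot al be : gram al be != 0 -> exists k, be = rotz k al.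
Proof.
have wP x ga : starw x ga != 0 -> exists k, rotz k ga = x.
  rewrite mulf_eq0 negb_or => /andP[_ nz].
  suff /existsP[k /eqP E] : [exists k, rotz k ga == x] by exists k.
  apply: contraNT nz => /existsPn no.
  by rewrite big1 // => k _; rewrite (negbTE (no k)) mulr0.
move=> nz; have [ga] : exists ga, starw al ga * starw be ga != 0.
  apply/existsP; apply: contraNT nz => /existsPn no.
  by rewrite /gram big1 // => ga _; apply/eqP; rewrite -[_ == _]negbK.
rewrite mulf_eq0 negb_or => /andP[/wP[k <-] /wP[l <-]].
by exists (l - k); rewrite rotzD subrK.
Qed.

(** With trivial stabilizer only k = 0 contributes to the coordinate at [al] itself, which is
    therefore nonzero. *)
Lemma gram_gt0 al : (forall k, rotz k al = al -> k = 0) -> 0 < gram al al.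
Proof.
move=> free_al; have wal : starw al al = (2 * n%:R)^-1.
  rewrite /starw (bigD1 0) //= rotz0 eqxx csn0 mulr1.
  rewrite big1 ?addr0 ?mulr1 // => k nk.
  by case: eqP => [/free_al k0|]; [rewrite k0 eqxx in nk | rewrite mulr0].
rewrite /gram (bigD1 al) //= ltr_wpDr //.
  by apply: sumr_ge0 => ga _; rewrite -expr2 sqr_ge0.
rewrite wal -expr2 exprn_gt0 // invr_gt0 mulr_gt0 // ltr0n; exact: ltnW.
Qed.

End RotationKernel.

(** * Symmetrized tensors and orthogonal bases made of them *)

Section StarVectors.
Variables (R : realType) (n h d : nat) (V : vectType R[i]) (e : d.-tuple V).
Hypotheses (n1 : (1 < n)%N) (fe : free e).
Local Notation F := {ffun 'Z_(4 * n) -> 'I_d}.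
Local Notation star := (estar e (SD n) (varsigma R n h)).
Implicit Types (al be : F) (k s t : 'Z_(4 * n)).

Lemma varsigma_rot (k : 'Z_(4 * n)) :
  varsigma R n h (sda n ^+ k) = (2 * csn R h k)%:C%C.
Proof.
have kn : (k < 4 * n)%N.
  by rewrite -[X in (_ < X)%N](Zp_cast (one_lt_4n n1)).
rewrite (varsigma_a R h (Ordinal kn)) ?(ltnW n1) //.
by rewrite [X in cos X](_ : _ = angle R n h *+ k) // /angle -mulr_natr; ring.
Qed.

Lemma estarE al be : star al be = (starw R h al be)%:C%C.
Proof.
pose A := [set (sda n ^+ val k)%g | k : 'Z_(4 * n)].
have Ainj : {in 'Z_(4 * n) &,
    injective (fun k : 'Z_(4 * n) => (sda n ^+ val k)%g)}.
  by move=> k l _ _ /permP/(_ 0); rewrite !sda_expE !add0r !natr_Zp.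
have AS : A \subset SD n.
  by apply/subsetP => _ /imsetP[k _ ->]; rewrite groupX // mem_gen // set21.
(* Split the group into the rotations [A] and the rest, where the character vanishes. *)
rewrite /estar /symT scale_lfunE sum_lfunE (big_setID A) (setIidPr AS) /=.
rewrite [X in _ + X]big1 ?addr0; last first.
  move=> s /setDP[_ nsA]; rewrite /varsigma; case: pickP => [k /eqP Es|_].
    case/negP: nsA; apply/imsetP; exists (k%:R : 'Z_(4 * n)) => //.
    by rewrite /= val_Zp_nat ?one_lt_4n // modn_small.
  by rewrite scale0r lfunE.
rewrite big_imset //= ffunE /starw rmorphM rmorph_sum /= sum_ffunE.
have -> : varsigma R n h 1 = 2.
  by rewrite -(expg0 (sda n)) (varsigma_rot 0) csn0 mulr1 rmorph_nat.
rewrite card_SD // -[_ *: _]/(_ * _) !mulr_sumr; apply: eq_bigr => k _.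
rewrite varsigma_rot scale_lfunE !lfunE /= ffunE.
rewrite [X in _ *: X]ffunE tensor_basis //.
have -> : [ffun i => be ((sda n ^+ k)%g i)] = rotz k be.
  by apply/ffunP => i; rewrite !ffunE sda_expE natr_Zp.
rewrite -[_ *: _]/(_ * _) !rmorphM /= fmorphV rmorphM /= !rmorph_nat natrM.
have : n%:R != 0 :> R[i] by rewrite pnatr_eq0 -lt0n ltnW.
by move=> nz; field.
Qed.

Lemma tdot_estar al be : tdot (star al) (star be) = (gram R h al be)%:C%C.
Proof.
rewrite /tdot /gram rmorph_sum; apply: eq_bigr => ga _ /=.
have conj_real (x : R) : (x%:C%C : R[i])^* = x%:C%C.
  by apply: conj_Creal; apply/complex_realP; exists x.
by rewrite !estarE conj_real [RHS]rmorphM.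
Qed.

Lemma estar_eq0 al : (star al == 0) = (gram R h al al == 0).
Proof.
have <- : (tdot (star al) (star al) == 0) = (star al == 0) by exact: dnorm_eq0.
by rewrite tdot_estar (fmorph_eq0 (real_complex R)).
Qed.

Lemma estar_in_class al : star al \in symclass d (SD n) (varsigma R n h).
Proof. by apply: memv_img; apply: memvf. Qed.

Lemma symclass_sub_estar (U : {vspace _}) :
  (forall al, star al \in U) -> (symclass d (SD n) (varsigma R n h) <= U)%VS.
Proof.
move=> starU; apply/subvP => _ /memv_imgP[x _ ->].
have -> : x = \sum_al x al *: tensor e (fun i => tnth e (al i)).
  apply/ffunP => be; rewrite sum_ffunE (bigD1 be) //= big1 => [|al nal].
    by rewrite addr0 ffunE tensor_basis // eqxx /GRing.scale /= mulr1.
  by rewrite ffunE tensor_basis // eq_sym (negbTE nal) scaler0.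
by rewrite linear_sum rpred_sum // => al _; rewrite linearZ memvZ ?starU.
Qed.

Lemma estar_rot_pair s t al : csn R h t = 0 ->
  star (rotz s al) = (csn R h s)%:C%C *: star al
    + (snn R h s * snn R h t)%:C%C *: star (rotz t al).
Proof.
move=> ct0; apply/ffunP => be; rewrite 3!ffunE !estarE.
by rewrite (starw_rot_pair n1 s al be ct0) rmorphD !rmorphM.
Qed.

Lemma starbasis_of_cos0 t : csn R h t = 0 ->
  has_orthogonal_starbasis e (SD n) (varsigma R n h).
Proof.
move=> ct0; pose f : F -> F := rotz 1.
have f_inj : injective f by apply: can_inj (rotzK 1).
(* One representative per rotation orbit; each gives the two candidates at angles 0 and t theta, and
   zero vectors are discarded. *)
pose reps := [seq al <- enum F | froot f al == al].
pose X := undup [seq x <- [seq star al | al <- reps]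
  ++ [seq star (rotz t al) | al <- reps] | x != 0].
have XP x : x \in X -> [/\ x != 0 & exists2 al, froot f al = al
    & x = star al \/ x = star (rotz t al)].
  rewrite mem_undup mem_filter mem_cat => /andP[x0 /orP[]] /mapP[al];
    rewrite mem_filter => /andP[/eqP ral _] Ex; split=> //;
    by exists al => //; tauto.
have froot_rot k al : froot f (rotz k al) = froot f al.
  apply/eqP; rewrite (root_connect (fconnect_sym f_inj)) (fconnect_sym f_inj).
  by rewrite -[k]natr_Zp -iter_rotz1 fconnect_iter.
have X_orth : pairwise_orthogonal (@tdot _ _ _) X.
  apply/pairwise_orthogonalP; split.
    by rewrite /= undup_uniq andbT; apply/negP => /XP[]; rewrite eqxx.
  move=> x y /XP[_ [al ral Ex]] /XP[_ [be rbe Ey]] nxy.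
  rewrite -[LHS]/(tdot x y).
  (* In one orbit the two candidates differ by the rotation t, of cosine 0; distinct orbits are
     orthogonal anyway. *)
  have [Ea|nab] := eqVneq al be.
    have g0 k l : csn R h (k - l) = 0 ->
        tdot (star (rotz k al)) (star (rotz l al)) = 0.
      by move=> c0; rewrite tdot_estar gram_rot // c0 mul0r.
    have := g0 t 0; have := g0 0 t; rewrite !rotz0 subr0 sub0r csnN //.
    move=> /(_ ct0) E1 /(_ ct0) E2.
    by case: Ex Ey nxy => -> [] ->; rewrite -Ea ?eqxx.
  have no k l : gram R h (rotz k al) (rotz l be) = 0.
    apply/eqP; apply: contraNT nab => /gram_neq0_rot[m E].
    by rewrite -ral -rbe -(froot_rot l be) E !froot_rot.
  have := no 0 0; have := no 0 t; have := no t 0; have := no t t.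
  by rewrite !rotz0; case: Ex Ey => -> [] -> E1 E2 E3 E4;
    rewrite tdot_estar ?E1 ?E2 ?E3 ?E4.
have X_span al : froot f al = al ->
    star al \in <<X>>%VS /\ star (rotz t al) \in <<X>>%VS.
  move=> ral; have in_span x : x \in [seq star al | al <- reps]
      ++ [seq star (rotz t al) | al <- reps] -> x \in <<X>>%VS.
    have [-> _|x0 xs] := eqVneq x 0; first exact: mem0v.
    by rewrite memv_span // mem_undup mem_filter x0.
  have al_reps : al \in reps by rewrite mem_filter ral eqxx mem_enum.
  split; apply: in_span; rewrite mem_cat; apply/orP; [left|right];
    by apply/mapP; exists al.
exists X; split=> //; last by move=> x /XP[_ [al _ [] ->]]; eexists.
rewrite /basis_of (orthogonal_free X_orth) andbT eqEsubv; apply/andP; split.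
  by apply/span_subvP => x /XP[_ [al _ [] ->]]; apply: estar_in_class.
apply: symclass_sub_estar => al.
have /iter_findex <- : fconnect f (froot f al) al.
  by rewrite fconnect_sym // connect_root.
have [|s1 s2] := X_span (froot f al).
  by rewrite root_root //; exact: fconnect_sym.
by rewrite iter_rotz1 (estar_rot_pair _ _ ct0) memvD // memvZ.
Qed.

(** The basis must contain two distinct vectors from the orbit of a nonzero e*_al, since one cannot
    span its plane; their orthogonality yields the vanishing cosine. *)
Lemma cos0_of_starbasis : (1 < d)%N -> 0 < angle R n h < pi ->
  has_orthogonal_starbasis e (SD n) (varsigma R n h) ->
  exists t : 'Z_(4 * n), csn R h t = 0.
Proof.
move=> d1 ang [X [Xbasis Xorth Xstar]].
have [_ orth] := pairwise_orthogonalP Xorth.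
have nonorth u : u \in symclass d (SD n) (varsigma R n h) -> u != 0 ->
    exists2 x, x \in X & tdot u x != 0.
  rewrite -(span_basis Xbasis) => uX nu.
  apply/hasP; apply: contraNT nu => /hasPn oX.
  rewrite -(dnorm_eq0 (tdot (C := _) (I := _) (d := _))); apply/eqP.
  apply: (span_orthogonal (S1 := [:: u]) _ _ uX); last first.
    by rewrite memv_span ?mem_head.
  by apply/orthoPl => x /oX; rewrite negbK => /eqP.
(* The value at index 0 occurs nowhere else, so no nontrivial rotation fixes [al]. *)
pose al : F := [ffun i => if i == 0 then Ordinal (ltnW d1) else Ordinal d1].
have g0 : gram R h al al != 0.
  rewrite lt0r_neq0 // gram_gt0 // => k /ffunP/(_ 0).
  by rewrite !ffunE add0r eqxx; case: eqP.
have star_al0 : star al != 0 by rewrite estar_eq0.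
have [x0 Xx0] := nonorth _ (estar_in_class al) star_al0.
have [be Ex0] := Xstar _ Xx0; rewrite Ex0 tdot_estar fmorph_eq0.
move=> /gram_neq0_rot[s Ebe]; rewrite {be}Ebe in Ex0.
pose c1 := csn R h (1 : 'Z_(4 * n)).
(* The component of the next rotation orthogonal to [x0]; a basis vector not orthogonal to [u] will
   be the second one. *)
pose u := (- c1)%:C%C *: star (rotz s al) + star (rotz (1 + s) al).
have tdot_u ga : tdot u (star ga) =
    (- c1 * gram R h (rotz s al) ga + gram R h (rotz (1 + s) al) ga)%:C%C.
  by rewrite /u tdot_linearl !tdot_estar rmorphD [in RHS]rmorphM.
have u0 : u != 0.
  apply: contraTneq isT => u0; have := tdot_u (rotz (1 + s) al).
  rewrite u0 (linear0l (tdot (C := _) (I := _) (d := _))) => /esym/eqP.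
  (* If u were 0, this pairing would give 1 - c1 ^ 2 = 0, contradicting sin theta > 0. *)
  rewrite (fmorph_eq0 (real_complex R)) !gram_rot // subrr csn0.
  rewrite opprD addrCA subrr addr0 csnN // -/c1 mulrA -mulrDl.
  rewrite mulf_eq0 (negbTE g0) orbF.
  have := csn2Dsnn2 R h (1 : 'Z_(4 * n)); rewrite -/c1.
  have : 0 < snn R h (1 : 'Z_(4 * n)).
    by rewrite -[1]/(1%:R) snn_natr // mulr1n sin_gt0_pi.
  move=> s0 cs1 /eqP E; exfalso; nra.
have uU : u \in symclass d (SD n) (varsigma R n h).
  by rewrite memvD ?memvZ ?estar_in_class.
have [x1 Xx1] := nonorth _ uU u0.
have [ga Ex1] := Xstar _ Xx1; rewrite Ex1 tdot_u => ux1.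
have x01 : x0 != x1.
  apply: contraNneq ux1 => x01; have := tdot_u (rotz s al).
  rewrite -Ex0 x01 Ex1 tdot_u => ->.
  by rewrite !gram_rot // subrr addrK csn0 -/c1 mul1r mulNr addNr.
(* As [u] pairs nontrivially with [x1], so does one of its two terms, which places [ga] in the orbit
   of [al]. *)
have [t Ega] : exists t, ga = rotz t al.
  have [z|/gram_neq0_rot[k ->]] := eqVneq (gram R h (rotz s al) ga) 0;
    last by exists (k + s); rewrite rotzD.
  have [z'|/gram_neq0_rot[k ->]] := eqVneq (gram R h (rotz (1 + s) al) ga) 0.
    by case/negP: ux1; rewrite z z' mulr0 addr0.
  by exists (k + (1 + s)); rewrite rotzD.
exists (s - t); have := orth _ _ Xx0 Xx1 x01.
rewrite -[LHS]/(tdot x0 x1) Ex0 Ex1 Ega tdot_estar gram_rot // => /eqP.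
by rewrite fmorph_eq0 mulf_eq0 (negbTE g0) orbF => /eqP.
Qed.

End StarVectors.

Theorem theorem3p5 (R : realType) (n h d : nat) (V : vectType R[i])
    (dotV : {dot V for Num.conj}) (e : d.-tuple V) :
  (2 <= n)%N ->
  ~~ odd h -> (2 <= h <= 2 * n - 2)%N ->
  \dim {:V} = d -> (2 <= d)%N ->
  basis_of {:V} e -> orthonormal dotV e ->
  has_orthogonal_starbasis e (SD n) (varsigma R n h)
    <-> nu2 (h%:Q / (2 * n)%N%:Q) < 0.
Proof.
move=> n1 _ /andP[h2 hn] _ d2 /basis_free fe _.
have h0 : (0 < h)%N := ltnW h2.
rewrite -(odd_multiple_nu2 (ltnW n1) h0) -(csn_eq0P R h n1).
split=> [|[t ct0]]; last exact: starbasis_of_cos0 ct0.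
apply: cos0_of_starbasis => //; rewrite /angle.
have n0 : 0 < 2 * n%:R :> R by rewrite mulr_gt0 // ltr0n ltnW.
apply/andP; split; first by rewrite divr_gt0 // mulr_gt0 ?pi_gt0 // ltr0n.
rewrite ltr_pdivrMr // mulrC.
by rewrite ltr_pM2l ?pi_gt0 // -natrM ltr_nat; lia.
Qed.
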